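(* Let $q$ be an odd prime power, let $D$ be a derivation set on the line at infinity $\ell_\infty$ of $\mathrm{AG}(2,q^2)$, and let $K$ be an ellipse in $\mathrm{AG}(2,q^2)$. Then $K$ does not remain an oval in the Hall plane $\mathrm{Hall}(q^2)$ obtained from $D$; that is, some three distinct points of $K$ are collinear in $\mathrm{Hall}(q^2)$.
   Context: $\mathrm{AG}(2,q^2)=\mathrm{PG}(2,q^2)\setminus\ell_\infty$. A derivation set $D$ is a Baer subline of $\ell_\infty$, i.e. an image under a projectivity of $\ell_\infty$ of the standard one $\{(x:y:0)\mid x,y\in\mathrm{GF}(q),\ (x,y)\neq(0,0)\}$ (where $\ell_\infty: Z=0$). The affine Hall plane $\mathrm{Hall}(q^2)$ obtained from $D$ has as points the points of $\mathrm{AG}(2,q^2)$; its lines are the ''old lines'', i.e. the affine parts of the lines of $\mathrm{PG}(2,q^2)$ other than $\ell_\infty$ whose infinite point is not in $D$, and the ''new lines'', i.e. the affine parts $B\setminus\ell_\infty$ of the Baer subplanes $B$ (subplanes of order $q$) of $\mathrm{PG}(2,q^2)$ containing $D$. For the standard $D$ the new lines are the sets $\{(a+\lambda u,b+\lambda v): u,v\in\mathrm{GF}(q)\}$ with $a,b\in\mathrm{GF}(q^2)$, $\lambda\in\mathrm{GF}(q^2)^*$. An oval in a plane of order $n$ is a set of $n+1$ points no three of which are collinear. Conic means irreducible conic. An ellipse is a conic of $\mathrm{PG}(2,q^2)$ having no point on $\ell_\infty$; it has $q^2+1$ points, all affine. *)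

(* Defs.v *)
From HB Require Import structures.
From mathcomp Require Import all_boot all_order all_algebra.
From mathcomp Require Import mpoly.

Set Implicit Arguments.
Unset Strict Implicit.
Unset Printing Implicit Defensive.

Import GRing.Theory.
Local Open Scope ring_scope.

(* Incidence structures: a point set and a family of lines, a line being the
   set of its points. *)

Definition collinear (T : finType) (line : {set T} -> Prop) (P Q R : T) :=
  exists2 l, line l & [/\ P \in l, Q \in l & R \in l].

Definition is_oval (T : finType) (pts : {set T}) (line : {set T} -> Prop)
    (n : nat) (K : {set T}) :=
  [/\ K \subset pts, #|K| = n.+1 &
      forall P Q R, P \in K -> Q \in K -> R \in K ->
        P != Q -> P != R -> Q != R -> ~ collinear line P Q R].

Definition is_projective_plane (T : finType) (pts : {set T})
    (lns : {set {set T}}) (n : nat) :=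
  [/\ forall l, l \in lns -> l \subset pts /\ #|l| = n.+1,
      forall P Q, P \in pts -> Q \in pts -> P != Q ->
        exists! l, [/\ l \in lns, P \in l & Q \in l],
      forall l m, l \in lns -> m \in lns -> l != m ->
        exists! P, P \in l :&: m
    & exists2 X : {set T}, X \subset pts /\ #|X| = 4%N &
        forall l, l \in lns -> (#|X :&: l| <= 2)%N].

(* PG(2,F): a point is a one-dimensional subspace of F^3, encoded as the set of
   its vectors; a line is the set of points (X:Y:Z) with aX + bY + cZ = 0. *)

Notation pgpoint F := {set 'rV[F]_3}.

Definition vec3 (F : finFieldType) (x y z : F) : 'rV[F]_3 :=
  \row_(i < 3) [:: x; y; z]`_i.

Definition pt (F : finFieldType) (v : 'rV[F]_3) : pgpoint F :=
  [set a *: v | a : F].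

Definition pg_points (F : finFieldType) : {set pgpoint F} :=
  [set pt v | v : 'rV[F]_3 & v != 0].

Definition pg_line (F : finFieldType) (l : 'rV[F]_3) : {set pgpoint F} :=
  [set pt v | v : 'rV[F]_3 & (v != 0) && (v *m l^T == 0)].

Definition pg_lines (F : finFieldType) : {set {set pgpoint F}} :=
  [set pg_line l | l : 'rV[F]_3 & l != 0].

Definition linf (F : finFieldType) : {set pgpoint F} := pg_line (vec3 0 0 1).

Definition ag_points (F : finFieldType) : {set pgpoint F} :=
  pg_points F :\: linf F.

(* When #|F| = q ^ 2, the fixed points of x |-> x ^+ q form the unique subfield
   of order q of F. *)
Definition GFq (q : nat) (F : finFieldType) : {set F} :=
  [set x : F | x ^+ q == x].

Definition linf_pt (F : finFieldType) (u : 'rV[F]_2) : pgpoint F :=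
  pt (vec3 (u 0 0) (u 0 1) 0).

Definition standard_subline (q : nat) (F : finFieldType) : {set pgpoint F} :=
  [set linf_pt u | u : 'rV[F]_2 & (u != 0) && [forall i, u 0 i \in GFq q F]].

(* Values of a projectivity outside of linf are irrelevant. *)
Definition linf_projectivity (F : finFieldType)
    (phi : pgpoint F -> pgpoint F) :=
  exists2 M : 'M[F]_2, M \in unitmx &
    forall u, u != 0 -> phi (linf_pt u) = linf_pt (u *m M).

Definition derivation_set (q : nat) (F : finFieldType)
    (D : {set pgpoint F}) :=
  exists2 phi, linf_projectivity phi & D = phi @: standard_subline q F.

(* The lines of a subplane are the traces of the lines of PG(2,F) that meet it
   in at least two points. *)
Definition subplane (n : nat) (F : finFieldType) (B : {set pgpoint F}) :=
  B \subset pg_points F /\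
  is_projective_plane B
    [set l :&: B | l in pg_lines F & (1 < #|l :&: B|)%N] n.

Definition hall_old_line (F : finFieldType) (D l : {set pgpoint F}) :=
  exists m, [/\ m \in pg_lines F, m != linf F, [disjoint m :&: linf F & D]
              & l = m :\: linf F].

Definition hall_new_line (q : nat) (F : finFieldType)
    (D l : {set pgpoint F}) :=
  exists B, [/\ subplane q B, D \subset B & l = B :\: linf F].

Definition hall_line (q : nat) (F : finFieldType) (D l : {set pgpoint F}) :=
  hall_old_line D l \/ hall_new_line q D l.

(* msize p is the total degree of p plus one. *)
Definition irreducible_mpoly (n : nat) (L : fieldType) (p : {mpoly L[n]}) :=
  (1 < msize p)%N /\
  forall a b : {mpoly L[n]}, p = a * b ->
    (msize a <= 1)%N \/ (msize b <= 1)%N.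

(* Irreducibility of a conic is geometric: over F itself, a pair of conjugate
   lines (a single point of PG(2,F)) is also given by an irreducible form. *)
Definition abs_irreducible (n : nat) (F : fieldType) (p : {mpoly F[n]}) :=
  forall (L : fieldType) (iota : {rmorphism F -> L}),
    irreducible_mpoly (map_mpoly iota p).

Definition zero_set (F : finFieldType) (p : {mpoly F[3]}) : {set pgpoint F} :=
  [set pt v | v : 'rV[F]_3 & (v != 0) && (p.@[v 0] == 0)].

Definition conic (F : finFieldType) (K : {set pgpoint F}) :=
  exists p : {mpoly F[3]},
    [/\ p \is 2.-homog, abs_irreducible p & K = zero_set p].

Definition ellipse (F : finFieldType) (K : {set pgpoint F}) :=
  conic K /\ [disjoint K & linf F].

(* Main.v *)
Require Import Defs.
From HB Require Import structures.
From mathcomp Require Import all_boot all_order all_algebra.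
From mathcomp Require Import cyclic finfield closed_field.
From mathcomp Require Import mpoly ring zify.

Set Implicit Arguments.
Unset Strict Implicit.
Unset Printing Implicit Defensive.

Import GRing.Theory.

(** Write K in central form Q = r, with Q an anisotropic binary form and r <> 0
    (were r zero, K would be a pair of conjugate lines, against absolute
    irreducibility: [ternary_centered_reducible]). In the coordinates given by
    two directions spanning D, the form Q is proportional to the norm form
    N(x + y theta) of the quadratic extension E = F(theta), and D is the set of
    directions spanned by vectors d over k = GF(q).

    For points z, w of K the direction of z - w is determined by the product
    zw: if N(z) = N(w) = c, then (z - w) / conj(z - w) = - zw / c. Hence a
    triangle inscribed in K whose sides have given directions d1, d2, d3 has
    z1 z2, z1 z3, z2 z3 known, so it exists as soon as an explicit element of F
    is a square, namely - Delta c N(d1) N(d2) N(d3), with Delta the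
    discriminant. If the d_i are over k, the three sides are k-rational
    multiples of one scalar, so the vertices lie on one affine Baer subplane
    through D ([inscribed_triangle], [baer_subplane]).

    Since q + 1 >= 4, suitable d1, d2, d3 can be found in D unless
    - Delta c N(d) is a nonsquare for all d in D; and this would force
    N(d) N(d') to be a square for all d, d' over k. That is excluded by
    counting, in place of a character sum estimate ([subline_mixed]). Send an
    ordered pair of distinct points d, d' of D to the y in F for which
    d conj(d') is proportional to y + theta. There are q (q + 1) pairs. Their
    images are among the y with N(y + theta) a square, of which there are at
    most (q^2 - 1) / 2 ([card_square_norms]). No y has three preimages
    ([slope_fibre]): multiplication by y + theta would then map three points of
    the Baer subline D into D, hence preserve D, and an element of E outside F
    would be, up to a scalar of F, a zero of a quadratic polynomial over k,
    whereas all these split in F. So q (q + 1) <= q^2 - 1, which is absurd. *)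

(** * Squares in a field of order q^2 and its subfield of order q *)

Section FiniteField.
Local Open Scope ring_scope.
Variables (F : finFieldType) (q : nat).
Hypotheses (q_odd : odd q)
  (q_prime_power : exists p k : nat, [/\ prime p, (0 < k)%N & q = (p ^ k)%N])
  (cardF : #|F| = (q ^ 2)%N).

Lemma q_gt2 : (2 < q)%N.
Proof.
case: q_prime_power => p [k [pp k0 qE]].
have : (1 < q)%N by rewrite qE -{1}(expn0 p) ltn_exp2l ?prime_gt1.
by case: (q) q_odd => [|[|[|]]].
Qed.

Lemma q_pchar : exists p k : nat,
  [/\ p \in [pchar F], prime p, (0 < k)%N & q = (p ^ k)%N].
Proof.
case: q_prime_power => p [k [pp k0 qE]]; exists p, k; split => //.
by apply: (@card_finPcharP F p (k * 2)%N) => //; rewrite cardF qE expnM.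
Qed.

Lemma natr2_neq0 : 2%:R != 0 :> F.
Proof.
case: q_pchar => p [k [chF pp k0 qE]].
apply/negP; rewrite -(dvdn_pcharf chF) dvdn_prime2 // => /eqP p2.
by move: q_odd; rewrite qE p2 oddX; case: k k0 {qE}.
Qed.

Lemma exprDq (x y : F) : (x + y) ^+ q = x ^+ q + y ^+ q.
Proof.
case: q_pchar => p [k [chF pp k0 qE]].
apply: exprDn_pchar; rewrite qE pnatX; apply/orP; left.
by apply/pnatP; rewrite ?prime_gt0 // => r pr; rewrite dvdn_prime2 // => /eqP ->.
Qed.

Lemma exprNq (x : F) : (- x) ^+ q = - x ^+ q.
Proof. by rewrite exprNn -signr_odd q_odd expr1 mulN1r. Qed.

Lemma exprBq (x y : F) : (x - y) ^+ q = x ^+ q - y ^+ q.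
Proof. by rewrite exprDq exprNq. Qed.


Lemma GFq0 : 0 \in GFq q F.
Proof. by rewrite inE expr0n gtn_eqF // (ltn_trans _ q_gt2). Qed.
Lemma GFq1 : 1 \in GFq q F.
Proof. by rewrite inE expr1n. Qed.
Lemma GFqD x y : x \in GFq q F -> y \in GFq q F -> x + y \in GFq q F.
Proof. by rewrite !inE exprDq => /eqP -> /eqP ->. Qed.
Lemma GFqN x : x \in GFq q F -> - x \in GFq q F.
Proof. by rewrite !inE exprNq => /eqP ->. Qed.
Lemma GFqB x y : x \in GFq q F -> y \in GFq q F -> x - y \in GFq q F.
Proof. by move=> hx hy; rewrite GFqD ?GFqN. Qed.
Lemma GFqM x y : x \in GFq q F -> y \in GFq q F -> x * y \in GFq q F.
Proof. by rewrite !inE exprMn => /eqP -> /eqP ->. Qed.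
Lemma GFqV x : x \in GFq q F -> x^-1 \in GFq q F.
Proof. by rewrite !inE exprVn => /eqP ->. Qed.

Definition is_square (z : F) := [exists r : F, z == r ^+ 2].

Lemma is_squareX2 (r : F) : is_square (r ^+ 2).
Proof. by apply/existsP; exists r. Qed.

Lemma is_square0 : is_square 0.
Proof. by apply/existsP; exists 0; rewrite expr0n. Qed.

Lemma is_squareM x y : is_square x -> is_square y -> is_square (x * y).
Proof.
move=> /existsP[r /eqP ->] /existsP[s /eqP ->].
by rewrite -exprMn is_squareX2.
Qed.

Lemma is_square_mulX2 x r : r != 0 -> is_square (x * r ^+ 2) = is_square x.
Proof.
move=> r0; apply/idP/idP => h; last by rewrite is_squareM ?is_squareX2.
suff -> : x = x * r ^+ 2 * r^-1 ^+ 2 by rewrite is_squareM ?is_squareX2.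
by rewrite -mulrA -exprMn divff // expr1n mulr1.
Qed.

Lemma field_generator : exists2 g : F,
  (q ^ 2).-1.-primitive_root g & forall z, z != 0 -> exists i, z = g ^+ i.
Proof.
have n0 : (0 < (q ^ 2).-1)%N by have := q_gt2; case: (q) => [|[|n]].
pose rs := enum (predC1 (0 : F)).
have sz : size rs = (q ^ 2).-1.
  by rewrite -cardE -cardF -(cardC1 (0 : F)).
have ux z : z \in rs -> z != 0 by rewrite mem_enum.
have allu : all (q ^ 2).-1.-unity_root rs.
  apply/allP => z /ux z0; rewrite unity_rootE.
  apply/eqP/(mulfI z0); rewrite mulr1 -exprS prednK; first by rewrite -cardF expf_card.
  by rewrite expn_gt0 (ltn_trans _ q_gt2).
have /hasP[g _ gprim] := has_prim_root n0 allu (enum_uniq _) (eq_leq (esym sz)).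
exists g => // z z0.
have /unity_rootP zr : (q ^ 2).-1.-unity_root z by apply: (allP allu); rewrite mem_enum.
have [i ->] := prim_rootP gprim zr.
by exists i.
Qed.

Lemma is_squareMN x y : ~~ is_square x -> ~~ is_square y -> is_square (x * y).
Proof.
have [g _ gen] := field_generator.
have odd_exp z : ~~ is_square z -> exists2 i, odd i & z = g ^+ i.
  have [->|z0] := eqVneq z 0; first by rewrite is_square0.
  have [i ->] := gen z z0; case oi : (odd i); first by exists i.
  case/negP.
  by rewrite -(odd_double_half i) oi add0n -muln2 exprM is_squareX2.
move=> /odd_exp[i oi ->] /odd_exp[j oj ->]; rewrite -exprD.
rewrite -(odd_double_half (i + j)) oddD oi oj add0n -muln2 exprM.
exact: is_squareX2.
Qed.

(** If g generates the multiplicative group of F and g^i lies in GF(q), then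
    q + 1 divides i; as q is odd, i is even. *)
Lemma is_square_GFq x : x \in GFq q F -> is_square x.
Proof.
have [g gprim gen] := field_generator.
have [->|x0] := eqVneq x 0; first by rewrite is_square0.
have [i ->] := gen x x0; rewrite inE -exprM (eq_prim_root_expr gprim).
have -> : (i * q = i * q.-1 + i)%N by have := q_gt2; nia.
rewrite -{3}[i]add0n eqn_modDr mod0n.
have -> : ((q ^ 2).-1 = q.+1 * q.-1)%N by have := q_gt2; nia.
rewrite -[_ == _]/(_ %| _)%N dvdn_pmul2r; last by have := q_gt2; lia.
move=> d.
have : ~~ odd i by case/dvdnP: d => j ->; rewrite oddM /= q_odd andbF.
move=> /negbTE oi.
by rewrite -(odd_double_half i) oi add0n -muln2 exprM is_squareX2.
Qed.

Lemma card_GFq : #|GFq q F| = q.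
Proof.
have q2 := q_gt2.
apply/eqP; rewrite eqn_leq; apply/andP; split.
  have sz : size ('X^q - 'X : {poly F}) = q.+1.
    by rewrite size_polyDl size_polyXn // size_polyN size_polyX; lia.
  rewrite cardE -ltnS -sz; apply: max_poly_roots; last exact: enum_uniq.
    by rewrite -size_poly_gt0 sz.
  apply/allP => x; rewrite mem_enum inE => xq.
  by rewrite rootE !hornerE subr_eq0.
have [g gprim _] := field_generator.
have g0 : g != 0.
  apply/eqP => g0; have := prim_expr_order gprim; rewrite g0 expr0n.
  by case: eqP => [|_ /esym/eqP]; [nia | rewrite oner_eq0].
have : (0 |: [set g ^+ (j * q.+1) | j : 'I_(q.-1)] \subset GFq q F).
  apply/subsetP => x; rewrite in_setU1 => /orP[/eqP ->|/imsetP[j _ ->]].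
    exact: GFq0.
  rewrite inE -exprM (eq_prim_root_expr gprim).
  have -> : (j * q.+1 * q = j * q.+1 + j * (q ^ 2).-1)%N by nia.
  by rewrite addnC modnMDl.
move/subset_leq_card; rewrite cardsU1 card_imset.
  rewrite card_ord; case: imsetP => [[j _ /esym/eqP]|_]; last by rewrite /= add1n prednK //; lia.
  by rewrite expf_eq0 (negbTE g0) andbF.
move=> i j /eqP; rewrite (eq_prim_root_expr gprim) => /eqP.
have lt (k : 'I_q.-1) : (k * q.+1 < (q ^ 2).-1)%N by have := ltn_ord k; nia.
rewrite !modn_small // => /eqP; rewrite eqn_pmul2r // => /eqP.
exact: val_inj.
Qed.
End FiniteField.

(** * The norm form of a quadratic extension *)

Section NormForm.
Local Open Scope ring_scope.
Variables (F : finFieldType) (T N : F).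

(** The pair (x, y) stands for x + y theta, where theta^2 = T theta - N: [nf]
    is then the norm, [emul] the product and [econj] the conjugation of
    F[theta]. Anisotropy of the norm makes F[theta] a field. *)
Definition nf (z : F * F) := z.1 ^+ 2 + T * z.1 * z.2 + N * z.2 ^+ 2.
Definition emul (z w : F * F) :=
  (z.1 * w.1 - N * z.2 * w.2, z.1 * w.2 + z.2 * w.1 + T * z.2 * w.2).
Definition econj (z : F * F) := (z.1 + T * z.2, - z.2).
Definition cross (z w : F * F) := z.1 * w.2 - z.2 * w.1.
Definition anisotropic := forall z, nf z = 0 -> z = (0, 0).

Lemma nfM z w : nf (emul z w) = nf z * nf w.
Proof. by rewrite /nf /emul /=; ring. Qed.

Lemma nf_conj z : nf (econj z) = nf z.
Proof. by rewrite /nf /econj /=; ring. Qed.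

Lemma parallel_unique (P S : F) z w :
  P * z.2 = S * z.1 -> P * w.2 = S * w.1 -> cross z w != 0 -> P = 0 /\ S = 0.
Proof.
move=> ez ew cr; split; apply: (mulIf cr); rewrite mul0r.
  transitivity (z.1 * (P * w.2) - w.1 * (P * z.2)); first by rewrite /cross; ring.
  by rewrite ez ew; ring.
transitivity (w.2 * (S * z.1) - z.2 * (S * w.1)); first by rewrite /cross; ring.
by rewrite -ez -ew; ring.
Qed.

(** A binary quadratic form with three zeros on the projective line vanishes.
    Each coefficient is recovered from the three values by Cramer's rule, the
    determinant being the product of the three cross terms. *)
Lemma quadratic_three_zeros (c0 c1 c2 : F) (z1 z2 z3 : F * F) :
    cross z1 z2 != 0 -> cross z1 z3 != 0 -> cross z2 z3 != 0 ->
    (forall z, z \in [:: z1; z2; z3] ->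
       c0 * z.1 ^+ 2 + c1 * z.1 * z.2 + c2 * z.2 ^+ 2 = 0) ->
  [/\ c0 = 0, c1 = 0 & c2 = 0].
Proof.
move=> h12 h13 h23 hz.
have /hz : z1 \in [:: z1; z2; z3] by rewrite !inE eqxx.
have /hz : z2 \in [:: z1; z2; z3] by rewrite !inE eqxx ?orbT.
have /hz {hz} : z3 \in [:: z1; z2; z3] by rewrite !inE eqxx ?orbT.
set E3 := LHS; move=> e3; set E2 := LHS; move=> e2; set E1 := LHS; move=> e1.
have D0 : cross z1 z2 * cross z1 z3 * cross z2 z3 != 0 by rewrite !mulf_neq0.
split; apply: (mulIf D0); rewrite mul0r.
- transitivity (E1 * (z2.2 * z3.2 * cross z2 z3) - E2 * (z1.2 * z3.2 * cross z1 z3)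
                + E3 * (z1.2 * z2.2 * cross z1 z2)); last by rewrite e1 e2 e3; ring.
  by rewrite /E1 /E2 /E3 /cross; ring.
- transitivity (- E1 * ((z2.1 * z3.2 + z2.2 * z3.1) * cross z2 z3)
                + E2 * ((z1.1 * z3.2 + z1.2 * z3.1) * cross z1 z3)
                - E3 * ((z1.1 * z2.2 + z1.2 * z2.1) * cross z1 z2));
    last by rewrite e1 e2 e3; ring.
  by rewrite /E1 /E2 /E3 /cross; ring.
transitivity (E1 * (z2.1 * z3.1 * cross z2 z3) - E2 * (z1.1 * z3.1 * cross z1 z3)
              + E3 * (z1.1 * z2.1 * cross z1 z2)); last by rewrite e1 e2 e3; ring.
by rewrite /E1 /E2 /E3 /cross; ring.
Qed.

End NormForm.

(** * Inscribed triangles with sides in a Baer subline *)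

Section Triangle.
Local Open Scope ring_scope.
Variables (F : finFieldType) (q : nat).
Hypotheses (q_odd : odd q)
  (q_prime_power : exists p k : nat, [/\ prime p, (0 < k)%N & q = (p ^ k)%N])
  (cardF : #|F| = (q ^ 2)%N).
Variables (T N : F).
Hypothesis aniso : anisotropic T N.
Local Notation k := (GFq q F).
Local Notation nf := (nf T N).

(** The projective line over k, each point being given by a normalized
    coordinate vector. *)
Definition subline_reps : {set F * F} := (1, 0) |: [set (u, 1) | u in k].
Local Notation R := subline_reps.

Lemma subline_repsP d : d \in R -> [/\ d.1 \in k, d.2 \in k & d != (0, 0)].
Proof.
have k0 := GFq0 F q_odd q_prime_power; have k1 := GFq1 F q.
rewrite in_setU1 => /orP[/eqP ->|/imsetP[u uk ->]] /=; split => //.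
  by rewrite xpair_eqE oner_eq0.
by rewrite xpair_eqE oner_eq0 andbF.
Qed.

Lemma card_subline_reps : #|R| = q.+1.
Proof.
rewrite cardsU1 card_imset; last by move=> u v [].
rewrite card_GFq //; case: imsetP => [[u _ [_ /esym/eqP]]|_]; last by [].
by rewrite oner_eq0.
Qed.

Lemma cross_subline_reps d d' : d \in R -> d' \in R -> d != d' -> cross d d' != 0.
Proof.
rewrite !in_setU1 => /orP[/eqP ->|/imsetP[u uk ->]] /orP[/eqP ->|/imsetP[v vk ->]];
  rewrite /cross /= ?eqxx // => h.
- by rewrite mulr1 mul0r subr0 oner_eq0.
- by rewrite mulr0 mulr1 sub0r oppr_eq0 oner_eq0.
by rewrite mulr1 mul1r subr_eq0; apply: contra h => /eqP ->.
Qed.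

Lemma nf_neq0 z : z != (0, 0) -> nf z != 0.
Proof. by apply: contra => /eqP/aniso ->. Qed.

Let Delta := T ^+ 2 - 4%:R * N.
Let two0 : 2%:R != 0 :> F := natr2_neq0 q_odd q_prime_power cardF.

Let four0 : 4%:R != 0 :> F.
Proof. by rewrite (natrM _ 2 2) mulf_neq0. Qed.

(** A square root of the discriminant would put theta in F. *)
Lemma disc_nonsquare : ~~ is_square Delta.
Proof.
apply/existsP => -[s /eqP sE].
have : nf ((s - T) / 2%:R, 1) = 0.
  have -> : nf ((s - T) / 2%:R, 1) = (s ^+ 2 - Delta) / 4%:R.
    by rewrite /Delta /nf /=; field; rewrite four0 two0.
  by rewrite sE subrr mul0r.
by move/aniso => [_ /eqP]; rewrite oner_eq0.
Qed.

Let Delta0 : Delta != 0.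
Proof. by apply: contra disc_nonsquare => /eqP ->; rewrite is_square0. Qed.

Definition square_norms : {set F} := [set y | is_square (nf (y, 1))].

(** The equation nf (y, 1) = s^2 reads (2y + T)^2 - (2s)^2 = Delta: a
    hyperbola, whose points correspond to the nonzero values of 2y + T + 2s.
    The two roots s of each such y are distinct, the form being anisotropic. *)
Lemma card_square_norms : (2 * #|square_norms| <= (q ^ 2).-1)%N.
Proof.
pose s y := odflt 0 [pick r | nf (y, 1) == r ^+ 2].
have sP y : is_square (nf (y, 1)) -> nf (y, 1) = s y ^+ 2.
  rewrite /s => /existsP[r rE]; case: pickP => [t /eqP //|/(_ r)].
  by rewrite rE.
pose sg (b : bool) : F := if b then 2%:R else - 2%:R.
pose phi (p : F * bool) := 2%:R * p.1 + T + sg p.2 * s p.1.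
set Y := square_norms.
(* the two coordinates along the asymptotes have product Delta *)
have phiM y b : y \in Y -> phi (y, b) * phi (y, ~~ b) = Delta.
  rewrite inE => /sP yE.
  have -> : phi (y, b) * phi (y, ~~ b) = (2%:R * y + T) ^+ 2 - 4%:R * s y ^+ 2.
    by case: b; rewrite /phi /=; ring.
  by rewrite -yE /nf /Delta /=; ring.
have phi0 p : p.1 \in Y -> phi p != 0.
  by case: p => y b /(phiM y b) e; move: Delta0; rewrite -e mulf_eq0 negb_or => /andP[].
have phi_inj : {in setX Y [set: bool] &, injective phi}.
  move=> [y b] [y' b']; rewrite !in_setX !in_setT !andbT /= => yY yY' e.
  have e' : phi (y, ~~ b) = phi (y', ~~ b').
    by apply: (mulfI (phi0 (y, b) yY)); rewrite phiM // e phiM.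
  have ey : y = y'.
    have : phi (y, b) + phi (y, ~~ b) = phi (y', b') + phi (y', ~~ b') by rewrite e e'.
    have sum z c : phi (z, c) + phi (z, ~~ c) = 2%:R * (2%:R * z + T).
      by case: c; rewrite /phi /=; ring.
    by rewrite !sum => /(mulfI two0)/addIr/(mulfI two0).
  move: e; rewrite -ey => e; case: (b =P b') => [-> //|bb].
  have s0 : s y != 0.
    apply/eqP => s0; move: (yY); rewrite inE => /sP; rewrite s0 expr0n /=.
    by move/aniso => [_ /eqP]; rewrite oner_eq0.
  have : 2%:R * 2%:R * s y = 0.
    have [-> | ->] : 2%:R * 2%:R * s y = phi (y, b) - phi (y, b') \/
                     2%:R * 2%:R * s y = phi (y, b') - phi (y, b).
    - by case: b b' bb {e e'} => -[] // _; [left | right]; rewrite /phi /=; ring.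
    - by rewrite e subrr.
    - by rewrite e subrr.
  by move/eqP; rewrite !mulf_eq0 (negbTE two0) (negbTE s0).
rewrite -cardF mulnC -card_bool -cardsT -cardsX -(card_in_imset phi_inj).
rewrite -(cardsC1 (0 : F)); apply/subset_leq_card/subsetP => z /imsetP[[y b]].
by rewrite in_setX in_setC1 => /andP[yY _] ->; apply: phi0.
Qed.

(** The y for which p.1 conj(p.2) is proportional to y + theta. *)
Definition slope (p : (F * F) * (F * F)) :=
  let e := emul T N p.1 (econj T p.2) in e.1 / e.2.

(** As (y + theta) d' is proportional to d conj(d') d' = nf(d') d, it is
    parallel to d. *)
Lemma slope_eq d d' : cross d d' != 0 ->
  let e := emul T N (slope (d, d'), 1) d' in e.1 * d.2 = e.2 * d.1.
Proof.
move=> dd /=; apply/eqP; rewrite -subr_eq0; apply/eqP.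
set y := slope _.
have e2 : (emul T N d (econj T d')).2 != 0.
  by rewrite -oppr_eq0; apply: etrans dd; congr (_ != 0); rewrite /= /cross; ring.
have ye : y * (emul T N d (econj T d')).2 = (emul T N d (econj T d')).1.
  by rewrite /y /slope mulfVK.
transitivity (y * (emul T N d (econj T d')).2 - (emul T N d (econj T d')).1).
  by rewrite /=; ring.
by rewrite ye subrr.
Qed.

Lemma nf_slope d d' : cross d d' != 0 ->
  nf (slope (d, d'), 1) = nf d * nf d' * (cross d d')^-1 ^+ 2.
Proof.
move=> dd; rewrite -[nf d'](nf_conj T N) -nfM.
rewrite /slope /=; set e := emul _ _ _ _.
have -> : cross d d' = - e.2 by rewrite /e /cross /=; ring.
have e2 : e.2 != 0 by rewrite -oppr_eq0; apply: etrans dd; congr (_ != 0); rewrite /e /= /cross; ring.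
by rewrite /nf /=; field; rewrite ?oppr_eq0 e2.
Qed.

(** The d' over k such that (y + theta) d' has a direction over k are the
    zeros of a quadratic form in d', obtained by comparing the two coordinates
    P, S of this product with their images under the Frobenius map. With three
    zeros its coefficients vanish, which gives
    (T^q - T) nf (y, 1) = 0, hence T and N are over k and so is the
    discriminant; but elements of k are squares in F. *)
Lemma slope_fibre y :
  (#|[set p in setX R R | (p.1 != p.2) && (slope p == y)]| <= 2)%N.
Proof.
rewrite leqNgt; apply/negP => /card_gt2P[p1 [p2 [p3 [[h1 h2 h3] [n12 n23 n31]]]]].
set A := [set p in _ | _] in h1 h2 h3.
have AP (p : (F * F) * (F * F)) : p \in A -> [/\ p.1 \in R, p.2 \in R, cross p.1 p.2 != 0 &
   let e := emul T N (y, 1) p.2 in e.1 * p.1.2 = e.2 * p.1.1].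
  case: p => d d'; rewrite inE in_setX /= => /andP[/andP[dR dR'] /andP[dd /eqP <-]].
  by have cr := cross_subline_reps dR dR' dd; split => //; apply: slope_eq.
have e0 (p : (F * F) * (F * F)) : p \in A -> emul T N (y, 1) p.2 != (0, 0).
  case/AP => _ /subline_repsP[_ _ p20] _ _; apply/eqP => /(congr1 nf).
  rewrite nfM => /eqP; rewrite {3}/nf /= !(mul0r, mulr0, expr0n) !addr0 mulf_eq0.
  by rewrite !(negbTE (nf_neq0 _)) // xpair_eqE oner_eq0 andbF.
(* a pair of the fibre is determined by its second member *)
have inj (p p' : (F * F) * (F * F)) : p \in A -> p' \in A -> p != p' -> cross p.2 p'.2 != 0.
  move=> pA pA' pp'; have [r1 r2 _ eq1] := AP p pA; have [r1' r2' _ eq2] := AP p' pA'.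
  apply: cross_subline_reps => //; apply: contra pp' => /eqP e2.
  have [/eqP e1|ne1] := boolP (p.1 == p'.1).
    by case: (p) (p') e1 e2 => [? ?] [? ?] /= -> ->.
  have cr := cross_subline_reps r1 r1' ne1.
  rewrite e2 in eq1; have [P0 S0] := parallel_unique eq1 eq2 cr.
  case/eqP: (e0 p pA); rewrite e2; exact: injective_projections.
pose a := y ^+ q; pose t := T ^+ q; pose n := N ^+ q.
have [] := @quadratic_three_zeros F (y - a) (y * (a + t) - N - a * (y + T) + n)
             (n * (y + T) - N * (a + t)) p1.2 p2.2 p3.2.
- exact: inj.
- by apply: inj => //; rewrite eq_sym.
- exact: inj.
- move=> z hz; have [p pA ->] : exists2 p, p \in A & z = p.2.
    by move: hz; rewrite !inE => /or3P[] /eqP ->; [exists p1|exists p2|exists p3].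
  have [/subline_repsP[k1 k2 n0] /subline_repsP[k3 k4 _] _ /=] := AP p pA.
  set P := (X in X * _ = _); set S := (X in _ = X * _) => eq1.
  move: k1 k2 k3 k4; rewrite !inE => /eqP k1 /eqP k2 /eqP k3 /eqP k4.
  have eq2 : P ^+ q * p.1.2 = S ^+ q * p.1.1.
    by move: (congr1 (fun x => x ^+ q) eq1); rewrite !exprMn k1 k2.
  have PS : P * S ^+ q - P ^+ q * S = 0.
    have [p0|p0] := eqVneq p.1.1 0; last first.
      apply: (mulIf p0); rewrite mul0r mulrBl -[_ * S * _]mulrA -eq1.
      by rewrite -[P * S ^+ q * _]mulrA -eq2; ring.
    have r0 : p.1.2 != 0.
      by move: n0; rewrite [p.1]surjective_pairing p0 xpair_eqE eqxx.
    by move: eq1 eq2; rewrite p0 !mulr0 => /eqP; rewrite mulf_eq0 (negbTE r0) orbF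
      => /eqP -> /eqP; rewrite mulf_eq0 (negbTE r0) orbF => /eqP ->; ring.
  rewrite -PS.
  have -> : P ^+ q = a * p.2.1 - n * p.2.2.
    by rewrite /P mulr1 exprBq // !exprMn k3 k4.
  have -> : S ^+ q = a * p.2.2 + p.2.1 + t * p.2.2.
    by rewrite /S mulr1 mul1r !exprDq // !exprMn k3 k4.
  by rewrite /P /S; ring.
move=> /eqP; rewrite subr_eq0 => /eqP ya; rewrite -ya => c1 c2.
have nN : n = N - y * (t - T).
  by apply/eqP; rewrite -subr_eq0 -[X in _ == X]c1; apply/eqP; ring.
have : (t - T) * nf (y, 1) = 0.
  by rewrite -[RHS]oppr0 -c2 nN /nf /=; ring.
move/eqP; rewrite mulf_eq0 (negbTE (nf_neq0 _)) ?orbF; last first.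
  by rewrite xpair_eqE oner_eq0 andbF.
rewrite subr_eq0 => /eqP tT; rewrite tT subrr mulr0 subr0 in nN.
case/negP: disc_nonsquare; apply: (is_square_GFq q_odd q_prime_power cardF).
have Tk : T \in k by rewrite inE -/t tT.
have Nk : N \in k by rewrite inE -/n nN.
have k1 := GFq1 F q.
have k4 : 4%:R \in k.
  by have -> : 4%:R = 1 + 1 + (1 + 1) :> F; [ring | rewrite !GFqD].
by rewrite GFqB // ?expr2 GFqM.
Qed.

(** Otherwise the slopes of the q (q + 1) pairs of distinct points would fall,
    at most two on each, on the at most (q^2 - 1) / 2 elements of
    [square_norms]. *)
Lemma subline_mixed :
  exists d d', [/\ d \in R, d' \in R & ~~ is_square (nf d * nf d')].
Proof.
have [/existsP[d /existsP[d' /and3P[dR dR' h]]]|] :=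
  boolP [exists d, exists d', [&& d \in R, d' \in R & ~~ is_square (nf d * nf d')]].
  by exists d, d'.
move=> /existsPn H; exfalso.
have sq d d' : d \in R -> d' \in R -> is_square (nf d * nf d').
  by move=> dR dR'; move/existsPn/(_ d'): (H d); rewrite dR dR' /= negbK.
pose off := [set p in setX R R | p.1 != p.2].
have off_ge : (q.+1 * q <= #|off|)%N.
  have : (#|setX R R :&: [set p | p.1 == p.2]| <= q.+1)%N.
    rewrite -card_subline_reps -(card_imset R (f := fun d => (d, d))); last by move=> ? ? [].
    apply/subset_leq_card/subsetP => -[d d']; rewrite in_setI in_setX in_set /= => /andP[/andP[dR _] /eqP <-].
    by apply/imsetP; exists d.
  have := cardsID [set p | p.1 == p.2] (setX R R).
  rewrite cardsX card_subline_reps.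
  have -> : setX R R :\: [set p | p.1 == p.2] = off.
    by apply/setP => p; rewrite !inE andbC.
  by move: #|off| #|_ :&: _| => m n; nia.
have : (#|off| <= 2 * #|square_norms|)%N.
  rewrite -sum1_card (partition_big slope (mem square_norms)) /=.
    rewrite mulnC -sum_nat_const; apply: leq_sum => y _.
    rewrite sum1_card; apply: leq_trans (slope_fibre y); apply: eq_leq.
    apply: eq_card => p.
    by rewrite -[LHS]/((p \in off) && (slope p == y)) !inE andbA.
  move=> [d d']; rewrite in_set in_setX /= => /andP[/andP[dR dR'] dd].
  have cr := cross_subline_reps dR dR' dd.
  by rewrite in_set nf_slope // is_square_mulX2 ?invr_eq0 ?sq.
by have := card_square_norms; have := q_gt2 q_odd q_prime_power; nia.
Qed.

(** If c = - Delta r^2 nf(d1) nf(d2) nf(d3), then with delta = 2 theta - T, so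
    that delta^2 = Delta, and a prime denoting conjugation, the points
    r delta d1 d2 d3', r delta d1 d2' d3, r delta d1' d2 d3 are on the conic.
    The first two differ by r delta d1 (d2 d3' - d2' d3), where the last factor
    is delta times an element of k if the d_i are over k; similarly for the
    other sides. *)
Lemma inscribed_triangle c : c != 0 ->
  exists (w d1 d2 : F * F) (l : F),
    [/\ [/\ d1.1 \in k, d1.2 \in k, d2.1 \in k & d2.2 \in k],
        cross d1 d2 != 0, l != 0
      & [/\ nf w = c, nf (w.1 + l * d1.1, w.2 + l * d1.2) = c
          & nf (w.1 + l * d2.1, w.2 + l * d2.2) = c]].
Proof.
move=> c0.
(* h d is a square when the point at infinity d lies on tangents of the conic *)
pose h d := - (Delta * c) * nf d.
(* three points of square type, or one of square type and two of the other *)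
have [d1 [d2 [d3 [[R1 R2 R3] [n12 n13 n23] hsq]]]] : exists d1 d2 d3,
    [/\ [/\ d1 \in R, d2 \in R & d3 \in R], [/\ d1 != d2, d1 != d3 & d2 != d3]
      & is_square (h d1 * h d2 * h d3)].
  have [d [d' [dR dR' mix]]] := subline_mixed.
  have {mix} mix : is_square (h d) != is_square (h d').
    apply: contra mix => /eqP e.
    rewrite -(is_square_mulX2 _ (r := Delta * c)) ?mulf_neq0 //.
    have -> : nf d * nf d' * (Delta * c) ^+ 2 = h d * h d' by rewrite /h; ring.
    by case: (boolP (is_square (h d))) e => h1 /esym;
       [move=> h2; exact: is_squareM
       |move/negbT => h2; exact: (is_squareMN q_odd q_prime_power cardF h1 h2)].
  have [e [eR esq]] : exists e, e \in R /\ is_square (h e).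
    by case: (boolP (is_square (h d))) mix => h1 mix; [exists d | exists d'; split=> //; case: (is_square (h d')) mix].
  pose G := [set d in R | is_square (h d)].
  have [/card_gt2P[d1 [d2 [d3 [[h1 h2 h3] [n12 n23 n31]]]]]|G2] := ltnP 2 #|G|.
    move: h1 h2 h3 => /setIdP[R1 s1] /setIdP[R2 s2] /setIdP[R3 s3].
    exists d1, d2, d3; split=> //; last exact: is_squareM (is_squareM s1 s2) s3.
    by split=> //; rewrite eq_sym.
  have : (1 < #|R :\: G|)%N.
    have := cardsID G R; rewrite card_subline_reps (setIidPr _); last first.
      by apply/subsetP => x; rewrite in_set => /andP[].
    by have := q_gt2 q_odd q_prime_power; lia.
  case/card_gt1P => d1 [d2 [/setDP[R1 h1] /setDP[R2 h2] n12]].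
  rewrite inE R1 in h1; rewrite inE R2 in h2.
  exists d1, d2, e; split => //.
    by split => //; [apply: contraNneq h1 | apply: contraNneq h2] => ->.
  exact: is_squareM (is_squareMN q_odd q_prime_power cardF h1 h2) esq.
have [k11 k12 z1] := subline_repsP R1.
have [k21 k22 z2] := subline_repsP R2.
have [k31 k32 z3] := subline_repsP R3.
have {n12} n12 := cross_subline_reps R1 R2 n12.
have {n13} n13 := cross_subline_reps R1 R3 n13.
have {n23} n23 := cross_subline_reps R2 R3 n23.
have {z1} z1 := nf_neq0 z1; have {z2} z2 := nf_neq0 z2; have {z3} z3 := nf_neq0 z3.
have [r [r0 rE]] : exists r, r != 0 /\ c = - Delta * r ^+ 2 * (nf d1 * nf d2 * nf d3).
  case/existsP: hsq => s /eqP sE.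
  exists (s / (Delta ^+ 2 * c * (nf d1 * nf d2 * nf d3))).
  have s0 : s != 0.
    apply: contraTneq isT => s0; move/eqP: sE.
    by rewrite s0 expr0n /h !(mulf_eq0, oppr_eq0) (negbTE Delta0) (negbTE c0) (negbTE z1) (negbTE z2) (negbTE z3).
  split; first by rewrite !mulf_neq0 ?invr_eq0 ?mulf_neq0 ?expf_neq0.
  rewrite expr_div_n -sE /h; field.
  by rewrite z1 z2 z3 c0 Delta0.
(* the first factor is r (2 theta - T) *)
pose mk e1 e2 e3 := emul T N (- r * T, 2%:R * r) (emul T N e1 (emul T N e2 e3)).
have mk_on e1 e2 e3 : nf e1 * nf e2 * nf e3 = nf d1 * nf d2 * nf d3 ->
    nf (mk e1 e2 e3) = c.
  move=> e; rewrite /mk !nfM rE -e.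
  have -> : nf (- r * T, 2%:R * r) = - Delta * r ^+ 2 by rewrite /nf /Delta /=; ring.
  by ring.
exists (mk d1 d2 (econj T d3)).
exists (cross d2 d3 * d1.1, cross d2 d3 * d1.2).
exists (cross d1 d3 * d2.1, cross d1 d3 * d2.2), (r * Delta).
split => /=; last split.
- by rewrite /cross !GFqM ?GFqB ?GFqM.
- have -> : cross (cross d2 d3 * d1.1, cross d2 d3 * d1.2)
                  (cross d1 d3 * d2.1, cross d1 d3 * d2.2)
            = cross d2 d3 * cross d1 d3 * cross d1 d2 by rewrite /cross /=; ring.
  by rewrite !mulf_neq0.
- by rewrite mulf_neq0.
- by apply: mk_on; rewrite nf_conj.
- rewrite -[RHS](mk_on d1 (econj T d2) d3) ?nf_conj //; congr nf.
  by apply: injective_projections; rewrite /mk /emul /econj /cross /Delta /=; ring.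
rewrite -[RHS](mk_on (econj T d1) d2 d3) ?nf_conj //; congr nf.
by apply: injective_projections; rewrite /mk /emul /econj /cross /Delta /=; ring.
Qed.
End Triangle.

(** * Coordinates in the projective plane over F *)

Section Vectors.
Local Open Scope ring_scope.
Variable F : finFieldType.
Implicit Types (v w m : 'rV[F]_3).

Definition dot3 v w := v 0 0 * w 0 0 + v 0 1 * w 0 1 + v 0 2%:R * w 0 2%:R.
Definition cross3 v w :=
  vec3 (v 0 1 * w 0 2%:R - v 0 2%:R * w 0 1)
       (v 0 2%:R * w 0 0 - v 0 0 * w 0 2%:R)
       (v 0 0 * w 0 1 - v 0 1 * w 0 0).

Lemma vec3E x y z :
  ((@vec3 F x y z 0 0 = x) * (vec3 x y z 0 1 = y) * (vec3 x y z 0 2%:R = z))%type.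
Proof. by rewrite !mxE. Qed.

Lemma eq_vec3 v w :
  v 0 0 = w 0 0 -> v 0 1 = w 0 1 -> v 0 2%:R = w 0 2%:R -> v = w.
Proof.
move=> e0 e1 e2; apply/rowP => -[[|[|[|//]]] lt].
- by rewrite (_ : Ordinal lt = 0) //; apply: val_inj.
- by rewrite (_ : Ordinal lt = 1) //; apply: val_inj.
by rewrite (_ : Ordinal lt = 2%:R) //; apply: val_inj.
Qed.

Lemma vec3_eq0 (x y z : F) : (vec3 x y z == 0) = [&& x == 0, y == 0 & z == 0].
Proof.
apply/eqP/and3P => [h|[/eqP -> /eqP -> /eqP ->]].
  by move: (vec3E x y z); rewrite h !mxE => -[[<- <-] <-].
by apply: eq_vec3; rewrite !(vec3E, mxE).
Qed.

Lemma vec3_eta v : v = vec3 (v 0 0) (v 0 1) (v 0 2%:R).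
Proof. by apply: eq_vec3; rewrite !vec3E. Qed.

Lemma vec3_neq0 v : v != 0 -> [|| v 0 0 != 0, v 0 1 != 0 | v 0 2%:R != 0].
Proof.
apply: contraR; rewrite !negb_or !negbK => /and3P[/eqP e0 /eqP e1 /eqP e2].
by apply/eqP/eq_vec3; rewrite !mxE.
Qed.

Lemma mulmx_tr_eq0 v w : (v *m w^T == 0) = (dot3 v w == 0).
Proof.
have -> : v *m w^T = (dot3 v w)%:M.
  apply/rowP => i; rewrite ord1 !mxE eqxx mulr1n /dot3.
  rewrite !big_ord_recl big_ord0 addr0 !mxE addrA.
  by congr (_ + v _ _ * w _ _ + v _ _ * w _ _); apply: val_inj.
by apply/eqP/eqP => [/matrixP/(_ 0 0)|->]; rewrite ?raddf0 // !mxE eqxx mulr1n.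
Qed.

Lemma dot3_crossl v w : dot3 v (cross3 v w) = 0.
Proof. by rewrite /dot3 !vec3E; ring. Qed.

Lemma dot3_crossr v w : dot3 w (cross3 v w) = 0.
Proof. by rewrite /dot3 !vec3E; ring. Qed.

Lemma dot3C v w : dot3 v w = dot3 w v.
Proof. by rewrite /dot3; ring. Qed.

Lemma dot3Z a v w : dot3 v (a *: w) = a * dot3 v w.
Proof. by rewrite /dot3 !mxE; ring. Qed.

Lemma cross3_eq0 v w : v != 0 -> w != 0 -> cross3 v w = 0 ->
  exists2 a, a != 0 & w = a *: v.
Proof.
move=> v0 w0 /rowP vw.
have := vw 0; have := vw 1; have := vw 2%:R; rewrite !vec3E !mxE.
move=> /eqP; rewrite subr_eq0 => /eqP e2 /eqP; rewrite subr_eq0 => /eqP e1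
       /eqP; rewrite subr_eq0 => /eqP e0.
suff [a wa] : exists a, w = a *: v.
  by exists a => //; apply: contra w0 => /eqP a0; rewrite wa a0 scale0r.
have [n0|n0|n0] := or3P (vec3_neq0 v0);
  [exists (w 0 0 / v 0 0)|exists (w 0 1 / v 0 1)|exists (w 0 2%:R / v 0 2%:R)];
  apply: eq_vec3; rewrite mxE; apply: (mulIf n0); rewrite [RHS]mulrAC mulfVK //;
  rewrite [LHS]mulrC [RHS]mulrC; first [done|exact: e0|exact: esym e0|exact: e1
    |exact: esym e1|exact: e2|exact: esym e2].
Qed.

Lemma dot3_cross3 v1 v2 m : cross3 v1 v2 != 0 -> m != 0 ->
  dot3 v1 m = 0 -> dot3 v2 m = 0 ->
  exists2 a, a != 0 & m = a *: cross3 v1 v2.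
Proof.
move=> n0 m0 h1 h2; apply: cross3_eq0 => //.
have -> : cross3 (cross3 v1 v2) m = dot3 v1 m *: v2 - dot3 v2 m *: v1.
  by apply: eq_vec3; rewrite !vec3E !mxE /= /dot3; ring.
by rewrite h1 h2 !scale0r subrr.
Qed.

Lemma pt_scale a v : a != 0 -> pt (a *: v) = pt v.
Proof.
move=> a0; apply/setP => x; apply/imsetP/imsetP => -[b _ ->].
  by exists (b * a); rewrite ?scalerA.
by exists (b / a); rewrite // scalerA mulfVK.
Qed.

Lemma pt_eqP v w : v != 0 -> w != 0 -> reflect (exists2 a, a != 0 & w = a *: v) (pt v == pt w).
Proof.
move=> v0 w0; apply: (iffP eqP) => [e|[a a0 ->]]; last by rewrite pt_scale.
have : w \in pt v by rewrite e; apply/imsetP; exists 1; rewrite ?scale1r.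
case/imsetP => a _ wa; exists a => //.
by apply: contra w0 => /eqP a0; rewrite wa a0 scale0r.
Qed.

Lemma mem_pg_line l v : v != 0 -> (pt v \in pg_line l) = (dot3 v l == 0).
Proof.
move=> v0; apply/imsetP/idP => [[w /[!inE] /andP[w0 wl] /esym/eqP e]|vl].
  case: (pt_eqP w0 v0 e) => a a0 ->.
  by rewrite dot3C dot3Z dot3C mulf_eq0 -mulmx_tr_eq0 wl orbT.
by exists v; rewrite // inE v0 mulmx_tr_eq0.
Qed.

Lemma mem_linf v : v != 0 -> (pt v \in linf F) = (v 0 2%:R == 0).
Proof.
by move=> v0; rewrite mem_pg_line // /dot3 !vec3E !mulr0 !add0r mulr1.
Qed.

Lemma mem_pg_points v : v != 0 -> pt v \in pg_points F.
Proof. by move=> v0; apply/imsetP; exists v; rewrite ?inE. Qed.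
End Vectors.

(** * Baer subplanes *)

Section BaerSubplane.
Local Open Scope ring_scope.
Variables (F : finFieldType) (q : nat).
Hypotheses (q_odd : odd q)
  (q_prime_power : exists p k : nat, [/\ prime p, (0 < k)%N & q = (p ^ k)%N])
  (cardF : #|F| = (q ^ 2)%N).
Local Notation k := (GFq q F).

Definition rational_vec : {set 'rV[F]_3} :=
  [set v : 'rV[F]_3 | (v != 0) && [forall i, v 0 i \in k]].
Local Notation V := rational_vec.

Lemma rational_vecP (v : 'rV[F]_3) : v \in V ->
  [/\ v != 0, v 0 0 \in k, v 0 1 \in k & v 0 2%:R \in k].
Proof. by rewrite inE => /andP[-> /forallP h]. Qed.

Lemma vec3_rational (x y z : F) : vec3 x y z != 0 ->
  x \in k -> y \in k -> z \in k -> vec3 x y z \in V.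
Proof.
by move=> n0 xk yk zk; rewrite inE n0; apply/forallP => -[[|[|[|//]]] ?]; rewrite mxE.
Qed.

Lemma cross3_rational (v w : 'rV[F]_3) : v \in V -> w \in V -> cross3 v w != 0 -> cross3 v w \in V.
Proof.
move=> /rational_vecP[_ ? ? ?] /rational_vecP[_ ? ? ?] n0.
by apply: vec3_rational; rewrite ?GFqB ?GFqM.
Qed.

(** Cramer's rule in the plane spanned by v1 and v2: the coefficients of v are
    quotients of coordinates of cross products, hence over k. *)
Lemma rational_span (v1 v2 v : 'rV[F]_3) : v1 \in V -> v2 \in V -> v \in V ->
    cross3 v1 v2 != 0 -> dot3 v (cross3 v1 v2) = 0 ->
  exists a b, [/\ a \in k, b \in k & v = a *: v1 + b *: v2].
Proof.
move=> /rational_vecP[_ h10 h11 h12] /rational_vecP[_ h20 h21 h22].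
move=> /rational_vecP[_ h0 h1 h2] n0 vn.
have span i : cross3 v1 v2 0 i != 0 ->
    v = (cross3 v v2 0 i / cross3 v1 v2 0 i) *: v1 +
        (cross3 v1 v 0 i / cross3 v1 v2 0 i) *: v2.
  move=> ni; apply: (scalerI ni); rewrite scalerDr !scalerA ![_ * (_ / _)]mulrC.
  rewrite !mulfVK //; apply/eqP; rewrite -subr_eq0 -[X in _ == X](scale0r (delta_mx 0 i)) -vn.
  apply/eqP; case: i {ni} => -[|[|[|//]]] lt; apply: eq_vec3;
    rewrite !mxE /= ?mxE /dot3 !vec3E; ring.
have rat i : i \in [:: 0; 1; 2%:R] -> cross3 v1 v2 0 i != 0 ->
    (cross3 v v2 0 i / cross3 v1 v2 0 i \in k) /\
    (cross3 v1 v 0 i / cross3 v1 v2 0 i \in k).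
  by rewrite !in_cons in_nil orbF => /or3P[] /eqP -> _; rewrite !vec3E;
    split; rewrite GFqM ?GFqV ?GFqB ?GFqM.
have [ni|ni|ni] := or3P (vec3_neq0 n0).
- by have [//|? ?] := rat 0 _ ni; eexists; eexists; split; [| |exact: span ni].
- by have [//|? ?] := rat 1 _ ni; eexists; eexists; split; [| |exact: span ni].
by have [//|? ?] := rat 2%:R _ ni; eexists; eexists; split; [| |exact: span ni].
Qed.

Variable g : 'M[F]_3.
Hypothesis g_unit : g \in unitmx.

(** The matrix g transports the subplane of the points with coordinates over k
    to an arbitrary position. *)
Definition baer_point (v : 'rV[F]_3) : {set 'rV[F]_3} := pt (v *m g).
Definition baer : {set pgpoint F} := [set baer_point v | v in V].
Definition baer_line (m : 'rV[F]_3) : {set pgpoint F} :=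
  [set baer_point v | v in V & dot3 v m == 0].

Let mulg_eq0 (v : 'rV[F]_3) : (v *m g == 0) = (v == 0).
Proof.
apply/eqP/eqP => [h|->]; last by rewrite mul0mx.
by rewrite -(mulmxK g_unit v) h mul0mx.
Qed.

Lemma baer_point_eqP (v w : 'rV[F]_3) : v != 0 -> w != 0 ->
  reflect (exists2 a, a != 0 & w = a *: v) (baer_point v == baer_point w).
Proof.
move=> v0 w0; apply: (iffP (pt_eqP _ _)); rewrite ?mulg_eq0 //; move=> [a a0].
  by rewrite scalemxAl => /(can_inj (mulmxK g_unit)) ->; exists a.
by move=> ->; exists a => //; rewrite scalemxAl.
Qed.

Lemma baer_point_cross v w : v != 0 -> w != 0 ->
  (baer_point v == baer_point w) = (cross3 v w == 0).
Proof.
move=> v0 w0; apply/baer_point_eqP/eqP => // [[a _ ->]|]; last exact: cross3_eq0.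
by apply: eq_vec3; rewrite !vec3E !mxE; ring.
Qed.

Lemma mem_baer_line v m : v \in V -> (baer_point v \in baer_line m) = (dot3 v m == 0).
Proof.
move=> vV; have [v0 _ _ _] := rational_vecP vV.
apply/imsetP/idP => [[w]|h]; last by exists v; rewrite // inE vV.
rewrite inE => /andP[wV wm] /esym/eqP; have [w0 _ _ _] := rational_vecP wV.
by case/(baer_point_eqP w0 v0) => a _ ->; rewrite dot3C dot3Z dot3C (eqP wm) mulr0.
Qed.

Lemma baer_lineZ a m : a != 0 -> baer_line (a *: m) = baer_line m.
Proof.
move=> a0; apply/setP => z.
by apply/imsetP/imsetP => -[v vm ->]; exists v => //; move: vm;
  rewrite !inE dot3Z mulf_eq0 (negbTE a0).
Qed.

Lemma pg_line_baer l : pg_line l :&: baer = baer_line (l *m g^T).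
Proof.
have e v : (dot3 (v *m g) l == 0) = (dot3 v (l *m g^T) == 0).
  by rewrite -!mulmx_tr_eq0 trmx_mul trmxK mulmxA.
apply/setP => x; rewrite in_setI; apply/andP/imsetP => [[xl /imsetP[v vV xE]]|[v]].
  have [v0 _ _ _] := rational_vecP vV.
  move: xl; rewrite xE mem_pg_line ?mulg_eq0 // e => vl.
  by exists v; rewrite // inE vV.
rewrite inE => /andP[vV vl] ->; have [v0 _ _ _] := rational_vecP vV.
by rewrite mem_pg_line ?mulg_eq0 // e vl; split=> //; apply: imset_f.
Qed.

Definition baer_lines : {set {set pgpoint F}} :=
  [set l :&: baer | l in pg_lines F & (1 < #|l :&: baer|)%N].

Lemma baer_line_mem v1 v2 : v1 \in V -> v2 \in V -> cross3 v1 v2 != 0 ->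
  baer_line (cross3 v1 v2) \in baer_lines.
Proof.
move=> V1 V2 n0; have [v10 _ _ _] := rational_vecP V1; have [v20 _ _ _] := rational_vecP V2.
have gT : g^T \in unitmx by rewrite unitmx_tr.
pose l := cross3 v1 v2 *m invmx g^T.
have lE : pg_line l :&: baer = baer_line (cross3 v1 v2).
  by rewrite pg_line_baer mulmxKV.
apply/imsetP; exists (pg_line l); last by rewrite lE.
rewrite inE lE; apply/andP; split.
  apply/imsetP; exists l => //; rewrite inE; apply: contra n0 => /eqP l0.
  by rewrite -(mulmxKV gT (cross3 v1 v2)) -/l l0 mul0mx.
apply/card_gt1P; exists (baer_point v1), (baer_point v2).
by rewrite !mem_baer_line // dot3_crossl dot3_crossr eqxx baer_point_cross.
Qed.

(** A line containing two rational points has rational coordinates, up to a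
    scalar: it is orthogonal to both points, so proportional to their cross
    product. *)
Lemma baer_linesP X : X \in baer_lines -> exists v1 v2,
  [/\ v1 \in V, v2 \in V, cross3 v1 v2 != 0 & X = baer_line (cross3 v1 v2)].
Proof.
case/imsetP => L; rewrite inE => /andP[/imsetP[l]].
rewrite inE => l0 -> /card_gt1P[x [y [xX yX xy]]] ->.
have m0 : l *m g^T != 0.
  apply: contra l0 => /eqP m0.
  by rewrite -(mulmxK (_ : g^T \in unitmx) l) ?unitmx_tr // m0 mul0mx.
move: xX yX; rewrite !pg_line_baer; move: (l *m g^T) m0 => m m0.
case/imsetP => v1; rewrite inE => /andP[V1 v1m] xE.
case/imsetP => v2; rewrite inE => /andP[V2 v2m] yE.
have [v10 _ _ _] := rational_vecP V1; have [v20 _ _ _] := rational_vecP V2.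
move: xy; rewrite xE yE baer_point_cross // => n0.
exists v1, v2; split => //.
have [a a0 ->] := dot3_cross3 n0 m0 (eqP v1m) (eqP v2m).
exact: baer_lineZ.
Qed.

(** The points of such a line are parametrized by the projective line over k,
    by means of the basis v1, v2. *)
Lemma card_baer_line v1 v2 : v1 \in V -> v2 \in V -> cross3 v1 v2 != 0 ->
  #|baer_line (cross3 v1 v2)| = q.+1.
Proof.
move=> V1 V2 n0; set n := cross3 v1 v2.
pose comb (d : F * F) := d.1 *: v1 + d.2 *: v2.
have cross_comb d d' : cross3 (comb d) (comb d') = cross d d' *: n.
  by apply: eq_vec3; rewrite /cross /n !(vec3E, mxE); ring.
have dot_comb d : dot3 (comb d) n = 0.
  by rewrite /dot3 /n !(vec3E, mxE); ring.
have comb0 d : d != (0, 0) -> comb d != 0.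
  apply: contraNneq => d0.
  have := cross_comb d (0, 1); have := cross_comb d (1, 0).
  rewrite d0 /cross /= !(mulr0, mulr1, subr0, sub0r).
  have c0 v : cross3 0 v = 0 by apply: eq_vec3; rewrite !(vec3E, mxE); ring.
  rewrite !c0.
  move=> /esym/eqP; rewrite scaler_eq0 oppr_eq0 (negbTE n0) orbF => /eqP d2.
  move=> /esym/eqP; rewrite scaler_eq0 (negbTE n0) orbF => /eqP d1.
  by rewrite -pair_eqE /= d1 d2 eqxx.
have combV d : d.1 \in k -> d.2 \in k -> d != (0, 0) -> comb d \in V.
  move=> k1 k2 /comb0 c0; have [_ ? ? ?] := rational_vecP V1.
  have [_ ? ? ?] := rational_vecP V2.
  by rewrite [comb d]vec3_eta vec3_rational -?vec3_eta // !mxE GFqD ?GFqM.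
have -> : baer_line n = [set baer_point (comb d) | d in subline_reps F q].
  apply/setP => x; apply/imsetP/imsetP => [[v]|[d dR ->]].
    rewrite in_set => /andP[vV /eqP vn] ->.
    have [a [b [ak bk vE]]] := rational_span V1 V2 vV n0 vn.
    have [v0 _ _ _] := rational_vecP vV.
    have [b0|b0] := eqVneq b 0.
      have a0 : a != 0.
        by apply: contra v0 => /eqP a0; rewrite vE a0 b0 !scale0r addr0.
      exists (1, 0); first by rewrite in_setU1 eqxx.
      apply/eqP/baer_point_eqP; rewrite ?comb0 // ?xpair_eqE ?oner_eq0 //.
      exists a^-1; rewrite ?invr_eq0 // /comb /= vE b0 !scale0r !addr0.
      by rewrite scalerA mulVf.
    exists (a / b, 1).
      by rewrite in_setU1; apply/orP; right; apply: imset_f; rewrite GFqM ?GFqV.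
    apply/eqP/baer_point_eqP; rewrite ?comb0 // ?xpair_eqE ?oner_eq0 ?andbF //.
    exists b^-1; rewrite ?invr_eq0 // /comb /= vE scalerDr !scalerA mulVf //.
    by rewrite mulrC.
  have [k1 k2 d0] := subline_repsP q_odd q_prime_power dR.
  by exists (comb d) => //; rewrite in_set combV // dot_comb eqxx.
rewrite card_in_imset ?(card_subline_reps q_odd q_prime_power cardF) //.
move=> d d' dR dR' /eqP; apply: contraTeq => dd.
have [k1 k2 d0] := subline_repsP q_odd q_prime_power dR.
have [k1' k2' d0'] := subline_repsP q_odd q_prime_power dR'.
rewrite baer_point_cross ?comb0 // cross_comb scaler_eq0 negb_or n0 andbT.
exact: cross_subline_reps dR dR' dd.
Qed.

Lemma baer_subplane : subplane q baer.
Proof.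
have rat0 v : v \in V -> v != 0 by case/rational_vecP.
split.
  apply/subsetP => x /imsetP[v /rat0 v0 ->].
  by apply: mem_pg_points; rewrite mulg_eq0.
split.
- move=> X XL; split; first by case/imsetP: XL => L _ ->; rewrite subsetIr.
  by case/baer_linesP: XL => v1 [v2 [V1 V2 n0 ->]]; rewrite card_baer_line.
- move=> P Q /imsetP[v1 V1 ->] /imsetP[v2 V2 ->].
  rewrite (baer_point_cross (rat0 _ V1) (rat0 _ V2)) => n0.
  exists (baer_line (cross3 v1 v2)); split.
    by rewrite baer_line_mem // !mem_baer_line // dot3_crossl dot3_crossr eqxx.
  move=> X [/baer_linesP[w1 [w2 [W1 W2 m0 ->]]]].
  rewrite !mem_baer_line // => /eqP h1 /eqP h2.
  by have [a a0 ->] := dot3_cross3 n0 m0 h1 h2; rewrite baer_lineZ.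
- move=> X Y /baer_linesP[v1 [v2 [V1 V2 n0 ->]]] /baer_linesP[w1 [w2 [W1 W2 m0 ->]]].
  have := cross3_rational V1 V2 n0; have := cross3_rational W1 W2 m0.
  move: (cross3 v1 v2) (cross3 w1 w2) n0 m0 => n m n0 m0 mV nV nm.
  have c0 : cross3 n m != 0.
    apply: contra nm => /eqP /(cross3_eq0 n0 m0)[a a0 ->].
    by rewrite baer_lineZ.
  have cV := cross3_rational nV mV c0.
  exists (baer_point (cross3 n m)); split.
    by rewrite in_setI !mem_baer_line // !(dot3C (cross3 _ _)) dot3_crossl dot3_crossr eqxx.
  move=> P; rewrite in_setI => /andP[/imsetP[v]].
  rewrite in_set => /andP[vV /eqP vn] ->; rewrite mem_baer_line // => /eqP vm.
  have v0 := rat0 v vV.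
  rewrite dot3C in vn; rewrite dot3C in vm.
  have [a a0 ->] := dot3_cross3 c0 v0 vn vm.
  by apply/eqP/baer_point_eqP => //; [rewrite scaler_eq0 negb_or a0 | exists a].
pose s := [:: baer_point (vec3 1 0 0); baer_point (vec3 0 1 0);
              baer_point (vec3 0 0 1); baer_point (vec3 1 1 1)].
have nz : (vec3 1 0 0 != 0 :> 'rV[F]_3) * (vec3 0 1 0 != 0 :> 'rV[F]_3)
  * (vec3 0 0 1 != 0 :> 'rV[F]_3) * (vec3 1 1 1 != 0 :> 'rV[F]_3).
  by rewrite !vec3_eq0 oner_eq0 !andbF.
have [k0 k1] : 0 \in k /\ 1 \in k by rewrite GFq0 ?GFq1.
have us : uniq s.
  rewrite /= !inE !negb_or !baer_point_cross ?nz // /cross3 !vec3_eq0 !vec3E.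
  by rewrite !(mulr0, mul0r, mulr1, subr0, sub0r, subrr, oppr_eq0, oner_eq0, andbF, eqxx).
exists [set x in s]; first split.
- apply/subsetP => x; rewrite in_set !inE.
  by case/or4P => /eqP ->; apply: imset_f; rewrite vec3_rational ?nz.
- by rewrite cardsE; apply/card_uniqP.
move=> X /baer_linesP[v1 [v2 [V1 V2 n0 ->]]].
move: (cross3 v1 v2) n0 => m m0.
have : (#|[set x in s] :&: baer_line m| <= count (mem (baer_line m)) s)%N.
  rewrite -size_filter; apply: leq_trans (card_size _); apply: subset_leq_card.
  by apply/subsetP => x; rewrite in_setI in_set mem_filter andbC.
move/leq_trans; apply; rewrite /= !mem_baer_line ?vec3_rational ?nz //.
rewrite /dot3 !vec3E !(mul0r, mul1r, add0r, addr0).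
have := vec3_neq0 m0.
have [->|x0] := eqVneq (m 0 0) 0; have [->|y0] := eqVneq (m 0 1) 0;
  have [->|z0] := eqVneq (m 0 2%:R) 0;
  rewrite ?eqxx ?add0r ?addr0 ?(negbTE x0) ?(negbTE y0) ?(negbTE z0) //;
  by case: (_ == 0).
Qed.
End BaerSubplane.

(** * Equations of ellipses *)

Section ConicEquation.
Local Open Scope ring_scope.

Definition ternary (L : fieldType) (a b c d e f : L) : {mpoly L[3]} :=
  a%:MP * 'X_0 ^+ 2 + b%:MP * ('X_0 * 'X_1) + c%:MP * 'X_1 ^+ 2
  + d%:MP * ('X_0 * 'X_2%:R) + e%:MP * ('X_1 * 'X_2%:R) + f%:MP * 'X_2%:R ^+ 2.

Lemma homog2_ternary (L : fieldType) (p : {mpoly L[3]}) : p \is 2.-homog ->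
  exists a b c d e f, p = ternary a b c d e f.
Proof.
move=> hp; rewrite (mpolyE p) big_seq.
apply: (big_ind (fun p => exists a b c d e f, p = ternary a b c d e f)).
- by exists 0, 0, 0, 0, 0, 0; rewrite /ternary mpolyC0; ring.
- move=> _ _ [a [b [c [d [e [f ->]]]]]] [a' [b' [c' [d' [e' [f' ->]]]]]].
  exists (a + a'), (b + b'), (c + c'), (d + d'), (e + e'), (f + f').
  by rewrite /ternary !mpolyCD; ring.
move=> m /(dhomog_mf hp) /=; rewrite mdegE mpolyXE_id !big_ord_recl !big_ord0.
have -> : lift ord0 ord0 = 1 :> 'I_3 by apply: val_inj.
have -> : lift ord0 (lift ord0 ord0) = 2%:R :> 'I_3 by apply: val_inj.
rewrite -[ord0]/(0 : 'I_3) -mul_mpolyC; move: (p@_m) => x.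
case: (m 0) => [|[|[|i]]]; case: (m 1) => [|[|[|j]]]; case: (m 2%:R) => [|[|[|k]]] //= _;
 [exists 0, 0, 0, 0, 0, x | exists 0, 0, 0, 0, x, 0 | exists 0, 0, x, 0, 0, 0
 |exists 0, 0, 0, x, 0, 0 | exists 0, x, 0, 0, 0, 0 | exists x, 0, 0, 0, 0, 0];
 by rewrite /ternary mpolyC0; ring.
Qed.

Lemma meval_ternary (L : fieldType) (a b c d e f : L) (v : 'I_3 -> L) :
  (ternary a b c d e f).@[v] =
  a * v 0 ^+ 2 + b * v 0 * v 1 + c * v 1 ^+ 2 + d * v 0 * v 2%:R
  + e * v 1 * v 2%:R + f * v 2%:R ^+ 2.
Proof. by rewrite /ternary !expr2 !(mevalD, mevalM, mevalC, mevalXU); ring. Qed.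

Lemma map_ternary (F L : fieldType) (iota : {rmorphism F -> L}) a b c d e f :
  map_mpoly iota (ternary a b c d e f) =
  ternary (iota a) (iota b) (iota c) (iota d) (iota e) (iota f).
Proof.
by rewrite /ternary !(rmorphD, rmorphM, rmorphXn) /= !map_mpolyC !map_mpolyX.
Qed.

Lemma msize_linear (L : fieldType) (a b c : L) : a != 0 ->
  (1 < msize (a%:MP * 'X_0 + b%:MP * 'X_1 + c%:MP * 'X_2%:R : {mpoly L[3]})%R)%N.
Proof.
move=> a0; rewrite ltnNge; apply: contra a0 => /msize1_polyC.
set u := (X in X = _) => uC.
have ev v : u.@[v] = a * v 0 + b * v 1 + c * v 2%:R.
  by rewrite /u !(mevalD, mevalM, mevalC, mevalXU).
(* a constant takes the same value at (1, 0, 0) and at the origin *)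
have : u.@[fun i => (i == 0)%:R] = u.@[fun=> 0] by rewrite uC !mevalC.
by rewrite !ev /= !(mulr0, mulr1, addr0) => ->.
Qed.

(** The ternary form here is Q (X - x Z, Y - y Z), where Q = a X^2 + b X Y +
    c Y^2. Over an algebraic closure Q is a product of two linear forms. *)
Lemma ternary_centered_reducible (F : finFieldType) (a b c x y : F) : a != 0 ->
  ~ abs_irreducible (ternary a b c (- (2%:R * a * x + b * y))
      (- (b * x + 2%:R * c * y)) (a * x ^+ 2 + b * x * y + c * y ^+ 2)).
Proof.
move=> a0 irr; have [L [iota _]] := countable_algebraic_closure F.
have ia0 : iota a != 0 by rewrite fmorph_eq0.
(* al and be are the roots of Q (t, 1) *)
have [al alE] := @solve_monicpoly L 2 (fun i => if i == 0 then - (iota c / iota a) else - (iota b / iota a)) isT.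
move: alE; rewrite !big_ord_recl big_ord0 /= expr0 expr1 mulr1 addr0 => alE.
pose be := - (iota b / iota a) - al.
have bE : iota b = - (iota a * (al + be)) by rewrite /be; field.
have cE : iota c = iota a * (al * be).
  have -> : al * be = - (iota b / iota a) * al - al ^+ 2 by rewrite /be; ring.
  by rewrite alE; field.
move: be bE cE {alE} => be bE cE.
have [_ /(_ ((iota a)%:MP * 'X_0 + (- (iota a * al))%:MP * 'X_1
            + (iota a * (al * iota y - iota x))%:MP * 'X_2%:R)
           (1%:MP * 'X_0 + (- be)%:MP * 'X_1 + (be * iota y - iota x)%:MP * 'X_2%:R))] := irr L iota.
case; last by rewrite leqNgt msize_linear ?oner_eq0.
  rewrite map_ternary /ternary !(rmorphN, rmorphD, rmorphM, rmorphXn, rmorph1) /= bE cE.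
  by rewrite !(rmorphN, rmorphD, rmorphM, rmorphXn, rmorph1) /=; ring.
by rewrite leqNgt msize_linear.
Qed.

(** The form Q is anisotropic because the conic has no point at infinity, so
    its discriminant is nonzero and, 2 being invertible, the conic has a
    centre (x0, y0). *)
Lemma ellipse_central_form (F : finFieldType) (K : {set pgpoint F}) :
    2%:R != 0 :> F -> ellipse K ->
  exists a b c x0 y0 r : F,
    [/\ r != 0,
        forall x y, a * x ^+ 2 + b * x * y + c * y ^+ 2 = 0 -> x = 0 /\ y = 0
      & forall x y, a * x ^+ 2 + b * x * y + c * y ^+ 2 = r ->
          pt (vec3 (x0 + x) (y0 + y) 1) \in K].
Proof.
move=> two0 [[p [hp irr KE]] dis].
have [a [b [c [d [e [f pE]]]]]] := homog2_ternary hp.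
have memK (v : 'rV[F]_3) : v != 0 -> p.@[v 0] = 0 -> pt v \in K.
  by move=> v0 pv; rewrite KE; apply/imsetP; exists v; rewrite // inE v0 pv eqxx.
have aniso x y : a * x ^+ 2 + b * x * y + c * y ^+ 2 = 0 -> x = 0 /\ y = 0.
  move=> h; have [|v0] := eqVneq (vec3 x y 0) 0.
    by move=> /eqP; rewrite vec3_eq0 => /and3P[/eqP -> /eqP ->].
  have inK : pt (vec3 x y 0) \in K.
    by apply: memK => //; rewrite pE meval_ternary !vec3E -[RHS]h; ring.
  have : pt (vec3 x y 0) \in linf F by rewrite mem_linf // vec3E.
  by rewrite (disjointFr dis inK).
have a0 : a != 0.
  apply/eqP => a0; have [|/eqP] := aniso 1 0; first by rewrite a0; ring.
  by rewrite oner_eq0.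
have disc0 : 4%:R * a * c - b ^+ 2 != 0.
  apply/eqP => h; have [|_ /eqP] := aniso b (- (2%:R * a)).
    by transitivity (a * (4%:R * a * c - b ^+ 2)); [ring | rewrite h mulr0].
  by rewrite oppr_eq0 mulf_eq0 (negbTE two0) (negbTE a0).
pose x0 := (b * e - 2%:R * c * d) / (4%:R * a * c - b ^+ 2).
pose y0 := (b * d - 2%:R * a * e) / (4%:R * a * c - b ^+ 2).
have dE : d = - (2%:R * a * x0 + b * y0) by rewrite /x0 /y0; field.
have eE : e = - (b * x0 + 2%:R * c * y0) by rewrite /x0 /y0; field.
pose r := a * x0 ^+ 2 + b * x0 * y0 + c * y0 ^+ 2 - f.
exists a, b, c, x0, y0, r; split=> // [|x y xyr].
  apply/eqP => /eqP; rewrite subr_eq0 => /eqP fE.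
  apply: (@ternary_centered_reducible F a b c x0 y0 a0).
  by rewrite -dE -eE fE -pE.
apply: memK; first by rewrite vec3_eq0 oner_eq0 !andbF.
rewrite pE meval_ternary !vec3E.
transitivity (a * x ^+ 2 + b * x * y + c * y ^+ 2 - r); last by rewrite xyr subrr.
by rewrite /r {1}dE {1}eE; ring.
Qed.

End ConicEquation.

(** * The new line through three points of an ellipse *)

Section NewLine.
Local Open Scope ring_scope.

Lemma mulmx_rows3 (F : finFieldType) (g : 'M[F]_3) (v r0 r1 r2 : 'rV[F]_3) :
    row 0 g = r0 -> row 1 g = r1 -> row 2%:R g = r2 ->
  v *m g = v 0 0 *: r0 + v 0 1 *: r1 + v 0 2%:R *: r2.
Proof.
move=> <- <- <-; rewrite mulmx_sum_row !big_ord_recl big_ord0 addr0 addrA.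
by congr (v _ _ *: row _ g + v _ _ *: row _ g + v _ _ *: row _ g); apply: val_inj.
Qed.

(** The Baer subplane is spanned by D and the vertices of the triangle: its
    matrix has rows l times the two directions spanning D and the first vertex
    of the triangle, so that the vertices become (0, 0, 1), (d1, 1) and
    (d2, 1). *)
Lemma new_line_triple (q : nat) (F : finFieldType) (q_odd : odd q)
    (q_prime_power : exists p k : nat, [/\ prime p, (0 < k)%N & q = (p ^ k)%N])
    (cardF : #|F| = (q ^ 2)%N)
    (D : {set pgpoint F}) (hD : derivation_set q D)
    (K : {set pgpoint F}) (hK : ellipse K) :
  exists P Q R : pgpoint F,
    [/\ P \in K, Q \in K & R \in K] /\ [/\ P != Q, P != R & Q != R] /\
    collinear (hall_line q D) P Q R.
Proof.
have two0 := natr2_neq0 q_odd q_prime_power cardF.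
have [a [b [c [x0 [y0 [r [r0 aniso onK]]]]]]] := ellipse_central_form two0 hK.
case: hD => phi [M Mu phiE] DE.
have k0 := GFq0 F q_odd q_prime_power; have k1 := GFq1 F q.
pose m00 := M 0 0; pose m01 := M 0 1; pose m10 := M 1 0; pose m11 := M 1 1.
pose Q x y := a * x ^+ 2 + b * x * y + c * y ^+ 2.
have mulM (u : 'rV[F]_2) : (u *m M) 0 0 = u 0 0 * m00 + u 0 1 * m10 /\
                           (u *m M) 0 1 = u 0 0 * m01 + u 0 1 * m11.
  by rewrite !mxE !big_ord_recl !big_ord0 !addr0; split;
    congr (_ * _ + u _ _ * M _ _); apply: val_inj.
have M_inj (s t : F) : s * m00 + t * m10 = 0 -> s * m01 + t * m11 = 0 -> s = 0 /\ t = 0.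
  pose u : 'rV[F]_2 := \row_i (if i == 0 then s else t).
  move=> h0 h1; have [] := mulM u; rewrite [u 0 0]mxE [u 0 1]mxE /= h0 h1 => e0 e1.
  have u0 : u = 0.
    rewrite -(mulmxK Mu u) (_ : u *m M = 0) ?mul0mx //.
    apply/rowP => -[[|[|//]] lt]; rewrite [RHS]mxE;
      [apply: (etrans _ e0) | apply: (etrans _ e1)];
      by congr ((u *m M) _ _); apply: val_inj.
  by have := congr1 (fun v : 'rV_2 => v 0 0) u0; have := congr1 (fun v : 'rV_2 => v 0 1) u0;
    rewrite !mxE /= => -> ->.
(* the form Q in the basis of the two rows of M *)
pose A := Q m00 m01; pose C := Q m10 m11.
pose B := 2%:R * a * m00 * m10 + b * (m00 * m11 + m01 * m10) + 2%:R * c * m01 * m11.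
have QE s t : Q (s * m00 + t * m10) (s * m01 + t * m11)
              = A * s ^+ 2 + B * s * t + C * t ^+ 2.
  by rewrite /A /B /C /Q; ring.
have A0 : A != 0.
  apply/eqP => /aniso[h0 h1].
  by have [||/eqP] := M_inj 1 0; rewrite ?h0 ?h1 ?oner_eq0 //; ring.
have nfE z : A * nf (B / A) (C / A) z =
    Q (z.1 * m00 + z.2 * m10) (z.1 * m01 + z.2 * m11).
  by rewrite QE /nf; field.
have an : anisotropic (B / A) (C / A).
  move=> z hz; have [h1 h2] : z.1 * m00 + z.2 * m10 = 0 /\ z.1 * m01 + z.2 * m11 = 0.
    by apply: aniso; rewrite -/(Q _ _) -nfE hz mulr0.
  by have [z1 z2] := M_inj _ _ h1 h2; apply: injective_projections.
have rA0 : r / A != 0 by rewrite mulf_neq0 ?invr_eq0.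
have [w [d1 [d2 [l [[k11 k12 k21 k22] cr l0 [n0 n1 n2]]]]]] :=
  inscribed_triangle q_odd q_prime_power cardF an rA0.
pose X z := x0 + (z.1 * m00 + z.2 * m10); pose Y z := y0 + (z.1 * m01 + z.2 * m11).
have onK' z : nf (B / A) (C / A) z = r / A -> pt (vec3 (X z) (Y z) 1) \in K.
  by move=> h; apply: onK; rewrite -/(Q _ _) -nfE h mulrC mulfVK.
pose g : 'M[F]_3 := \matrix_(i < 3)
  [:: l *: vec3 m00 m01 0; l *: vec3 m10 m11 0; vec3 (X w) (Y w) 1]`_i.
have mulg (v : 'rV[F]_3) : v *m g = vec3 (X (v 0 2%:R * w.1 + l * v 0 0, v 0 2%:R * w.2 + l * v 0 1)
                            - x0 + v 0 2%:R * x0)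
                            (Y (v 0 2%:R * w.1 + l * v 0 0, v 0 2%:R * w.2 + l * v 0 1)
                            - y0 + v 0 2%:R * y0)
                            (v 0 2%:R).
  rewrite (mulmx_rows3 v (rowK _ 0) (rowK _ 1) (rowK _ 2%:R)) /=.
  by apply: eq_vec3; rewrite !(vec3E, mxE) /= /X /Y /=; ring.
have gu : g \in unitmx.
  rewrite -row_free_unit -kermx_eq0; apply/rowV0P => v /sub_kermxP.
  rewrite mulg => /eqP; rewrite vec3_eq0 => /and3P[/eqP hx /eqP hy /eqP v2].
  rewrite v2 /X /Y /= in hx hy.
  have [h1 h2] : v 0 0 = 0 /\ v 0 1 = 0.
    apply: M_inj; apply: (mulfI l0); rewrite mulr0; [rewrite -hx | rewrite -hy]; ring.
  by apply: eq_vec3; rewrite mxE.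
have baer_pt z : baer_point g (vec3 z.1 z.2 1) =
   pt (vec3 (X (w.1 + l * z.1, w.2 + l * z.2)) (Y (w.1 + l * z.1, w.2 + l * z.2)) 1).
  by rewrite /baer_point mulg !vec3E !mul1r !subrK.
have nz x y : vec3 x y 1 != 0 :> 'rV[F]_3 by rewrite vec3_eq0 oner_eq0 !andbF.
have affV z : z.1 \in GFq q F -> z.2 \in GFq q F ->
    baer_point g (vec3 z.1 z.2 1) \in baer q g :\: linf F.
  move=> zk1 zk2; rewrite in_setD {1}baer_pt mem_linf // vec3E oner_eq0 /=.
  by apply: imset_f; apply: vec3_rational.
have Kz z : nf (B / A) (C / A) (w.1 + l * z.1, w.2 + l * z.2) = r / A ->
    baer_point g (vec3 z.1 z.2 1) \in K.
  by move=> h; rewrite baer_pt; apply: onK'.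
exists (baer_point g (vec3 ((0, 0) : F * F).1 ((0, 0) : F * F).2 1)), (baer_point g (vec3 d1.1 d1.2 1)),
  (baer_point g (vec3 d2.1 d2.2 1)).
split; [|split].
- by split; apply: Kz => //; rewrite /= !mulr0 !addr0 -surjective_pairing.
- have dist z z' : cross z z' != 0 \/ z = (0, 0) /\ z' != (0, 0) ->
     baer_point g (vec3 z.1 z.2 1) != baer_point g (vec3 z'.1 z'.2 1).
    rewrite (baer_point_cross gu) // => h; rewrite /cross3 vec3_eq0 !vec3E !mulr1 !mul1r.
    case: h => [h|[-> h]]; first by rewrite !negb_and h !orbT.
    rewrite /= !sub0r !subr0 oppr_eq0 !mul0r subrr eqxx andbT.
    by apply: contra h; case: z' => u v /= /andP[/eqP -> /eqP ->].
  have d10 : d1 != (0, 0) by apply: contra cr => /eqP ->; rewrite /cross /=; apply/eqP; ring.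
  have d20 : d2 != (0, 0) by apply: contra cr => /eqP ->; rewrite /cross /=; apply/eqP; ring.
  by split; apply: dist; [right|right|left].
exists (baer q g :\: linf F); last by split; apply: affV.
right; exists (baer q g); split => //; first exact: baer_subplane.
apply/subsetP => P; rewrite DE => /imsetP[s /imsetP[u]].
rewrite inE => /andP[u0 /forallP uk] -> ->.
rewrite phiE // /linf_pt.
have [-> ->] := mulM u.
have v0 : vec3 (u 0 0) (u 0 1) 0 != 0 :> 'rV[F]_3.
  rewrite vec3_eq0 eqxx andbT; apply: contra u0 => /andP[/eqP e0 /eqP e1].
  by apply/eqP/rowP => -[[|[|//]] lt]; rewrite mxE;
    [apply: (etrans _ e0) | apply: (etrans _ e1)]; congr (u _ _); apply: val_inj.
apply/imsetP; exists (vec3 (u 0 0) (u 0 1) 0); first exact: vec3_rational.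
rewrite /baer_point mulg -(pt_scale _ l0); congr pt.
by apply: eq_vec3; rewrite !(vec3E, mxE) /= /X /Y /= ?vec3E; ring.
Qed.
End NewLine.

Theorem theorem8p1 (q : nat) (F : finFieldType)
    (q_odd : odd q)
    (q_prime_power : exists p k : nat, [/\ prime p, 0 < k & q = p ^ k])
    (cardF : #|F| = q ^ 2)
    (D : {set pgpoint F}) (hD : derivation_set q D)
    (K : {set pgpoint F}) (hK : ellipse K) :
  ~ is_oval (ag_points F) (hall_line q D) (q ^ 2) K /\
  exists P Q R : pgpoint F,
    [/\ P \in K, Q \in K & R \in K] /\ [/\ P != Q, P != R & Q != R] /\
    collinear (hall_line q D) P Q R.
Proof.
have triple := new_line_triple q_odd q_prime_power cardF hD hK.
split=> // -[_ _ no3].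
case: triple => P [Q [R [[PK QK RK] [[PQ PR QR] col]]]].
exact: no3 PK QK RK PQ PR QR col.
Qed.
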